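(* Let $(\mathcal{M},d)$ be a Cartan-Hadamard manifold and let $S\subseteq\mathcal{M}$ be a g-convex subset. Let $n \ge 1$ and suppose $f_i:S\to\mathbb{R}$ is g-convex for $i=1,\ldots,n$. Then the following functions $S\to\mathbb{R}$ are also g-convex: 1. $X\mapsto \max_{i\in\{1,\ldots,n\}} f_i(X)$; 2. $X\mapsto \sum_{i=1}^n \alpha_i f_i(X)$, for any $\alpha_1,\ldots,\alpha_n\ge 0$.
   Context: A Cartan-Hadamard manifold is a Riemannian manifold of non-positive sectional curvature in which every pair of points is connected by a unique geodesic, which is distance-minimizing; $d$ is the Riemannian distance. A set $S\subseteq\mathcal{M}$ is geodesically convex (g-convex) if for any $x,y\in S$ there is a geodesic $\gamma:[0,1]\to\mathcal{M}$ with $\gamma(0)=x$, $\gamma(1)=y$ and $\gamma([0,1])\subseteq S$. A function $f:S\to\mathbb{R}$ is g-convex if $S$ is g-convex and $f\circ\gamma:[0,1]\to\mathbb{R}$ is convex in the usual sense for each geodesic segment $\gamma:[0,1]\to\mathcal{M}$ with image in $S$ and $\gamma(0)\ne\gamma(1)$. All functions considered are assumed continuous. *)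

(* Defs.v *)
From HB Require Import structures.
From mathcomp Require Import all_boot all_order all_algebra.
From mathcomp Require Import all_classical all_reals all_analysis.

Set Implicit Arguments.
Unset Strict Implicit.
Unset Printing Implicit Defensive.

Import Order.TTheory GRing.Theory Num.Theory.
Import numFieldNormedType.Exports.

Local Open Scope classical_set_scope.
Local Open Scope ring_scope.

(* C^oo on an open set U: every iterated directional derivative exists and is
   continuous at every point of U. *)
Definition smooth_on (R : realType) (V W : normedModType R)
    (U : set V) (f : V -> W) : Prop :=
  forall (s : seq V) (x : V), U x ->
    let g := foldr (fun v h => derive h ^~ v) f s in
    {for x, continuous g} /\ forall v, derivable g x v.

Section LocalTensors.
Context {R : realType} {m : nat}.
(* A metric tensor on an open subset of R^m; tangent vectors are row vectors. *)
Variable g : 'rV[R]_m -> 'M[R]_m.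

Definition inner (x u v : 'rV[R]_m) : R := (u *m g x *m v^T) 0 0.

Definition partial (i : 'I_m) (h : 'rV[R]_m -> R) : 'rV[R]_m -> R :=
  derive h ^~ (delta_mx 0 i).

(* christoffel k i j x is $\Gamma^k_{ij}(x)$. *)
Definition christoffel (k i j : 'I_m) (x : 'rV[R]_m) : R :=
  2^-1 * \sum_(l < m) invmx (g x) k l *
    (partial i (fun y => g y j l) x + partial j (fun y => g y i l) x
     - partial l (fun y => g y i j) x).

(* riemann l i j k x is $R^l_{ijk}(x)$, with the convention
   $R(\partial_i,\partial_j)\partial_k = \sum_l R^l_{ijk}\,\partial_l$ for
   $R(X,Y)Z = \nabla_X\nabla_Y Z - \nabla_Y\nabla_X Z - \nabla_{[X,Y]}Z$. *)
Definition riemann (l i j k : 'I_m) (x : 'rV[R]_m) : R :=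
  partial i (christoffel l j k) x - partial j (christoffel l i k) x
  + \sum_(p < m) (christoffel l i p x * christoffel p j k x
                  - christoffel l j p x * christoffel p i k x).

(* The vector $R(u,v)w$. *)
Definition curvature_op (x u v w : 'rV[R]_m) : 'rV[R]_m :=
  \row_(l < m) \sum_(i < m) \sum_(j < m) \sum_(k < m)
     riemann l i j k x * u 0 i * v 0 j * w 0 k.

Definition sectional_curvature (x u v : 'rV[R]_m) : R :=
  inner x (curvature_op x u v v) u /
  (inner x u u * inner x v v - inner x u v ^+ 2).

End LocalTensors.

(* A homeomorphism coord from the open set cdom onto an open subset of R^m, with
   inverse param; the values of coord and param elsewhere are irrelevant. *)
Record chart (R : realType) (m : nat) (T : topologicalType) := Chart {
  cdom : set T;
  coord : T -> 'rV[R]_m;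
  param : 'rV[R]_m -> T;
  cdom_open : open cdom;
  cimg_open : open (coord @` cdom);
  coordK : {in cdom, cancel coord param};
  coord_continuous : {in cdom, continuous coord};
  param_continuous : {in coord @` cdom, continuous param} }.

Definition cimg (R : realType) (m : nat) (T : topologicalType)
  (c : chart R m T) : set 'rV[R]_m := coord c @` cdom c.

Definition transition (R : realType) (m : nat) (T : topologicalType)
  (c c' : chart R m T) : 'rV[R]_m -> 'rV[R]_m := coord c' \o param c.

Definition overlap (R : realType) (m : nat) (T : topologicalType)
  (c c' : chart R m T) : set 'rV[R]_m := cimg c `&` param c @^-1` cdom c'.

(* A smooth Riemannian manifold of dimension m, given by a (not necessarily
   maximal) smooth atlas and the matrices of the metric in its charts.  The last
   field says that these matrices are the expressions of one tensor: the vector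
   with components v in c has components $D_v(\mathrm{transition})$ in c'. *)
Record riemannian_manifold (R : realType) (m : nat) := RiemannianManifold {
  carrier :> topologicalType;
  carrier_hausdorff : hausdorff_space carrier;
  carrier_second_countable : @second_countable carrier;
  atlas : set (chart R m carrier);
  chart_at : carrier -> chart R m carrier;
  chart_at_atlas : forall p, atlas (chart_at p);
  chart_at_dom : forall p, cdom (chart_at p) p;
  transition_smooth : forall c c', atlas c -> atlas c' ->
    smooth_on (overlap c c') (transition c c');
  metric : chart R m carrier -> 'rV[R]_m -> 'M[R]_m;
  metric_smooth : forall c, atlas c -> forall i j,
    smooth_on (cimg c) (fun x => metric c x i j);
  metric_sym : forall c, atlas c -> forall x, cimg c x ->
    (metric c x)^T = metric c x;
  metric_pos : forall c, atlas c -> forall x, cimg c x ->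
    forall v, v != 0 -> 0 < inner (metric c) x v v;
  metric_compat : forall c c', atlas c -> atlas c' ->
    forall x, overlap c c' x -> forall u v,
    inner (metric c) x u v =
    inner (metric c') (transition c c' x)
      (derive (transition c c') x u) (derive (transition c c') x v) }.

Section Riemannian.
Context {R : realType} {m : nat} (M : riemannian_manifold R m).

Definition smooth_curve (I : set R) (gamma : R -> M) : Prop :=
  {in I, continuous gamma} /\
  forall c, atlas c ->
    smooth_on (I `&` gamma @^-1` cdom c) (coord c \o gamma).

(* Smooth with zero covariant acceleration:
   $\ddot x^k + \sum_{i,j} \Gamma^k_{ij}(x)\, \dot x^i \dot x^j = 0$. *)
Definition geodesic_on (I : set R) (gamma : R -> M) : Prop :=
  smooth_curve I gamma /\
  forall c, atlas c -> forall t, I t -> cdom c (gamma t) ->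
  let x := coord c \o gamma in
  forall k : 'I_m,
    (derive1n 2 x t) 0 k +
    \sum_(i < m) \sum_(j < m)
      christoffel (metric c) k i j (x t) * (derive1 x t) 0 i * (derive1 x t) 0 j
    = 0.

(* A property of curves on open intervals, read for a curve on [a, b]: it is the
   restriction of a curve with that property on a larger open interval.  The
   values of gamma off [a, b] play no role. *)
Definition on_segment (P : set R -> (R -> M) -> Prop) (a b : R)
    (gamma : R -> M) : Prop :=
  exists2 e : R, 0 < e & exists2 delta : R -> M,
    P `](a - e), (b + e)[%classic delta & {in `[a, b], gamma =1 delta}.

Definition geodesic (gamma : R -> M) : Prop :=
  on_segment geodesic_on 0 1 gamma.

Inductive piecewise_smooth (gamma : R -> M) : R -> R -> Prop :=
| PiecewiseSmooth1 a b : a < b -> on_segment smooth_curve a b gamma ->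
    piecewise_smooth gamma a b
| PiecewiseSmoothCat a b c : piecewise_smooth gamma a b ->
    piecewise_smooth gamma b c -> piecewise_smooth gamma a c.

(* The norm of the velocity, which does not depend on the chart used; it is
   meaningful for a piecewise smooth curve except at finitely many times. *)
Definition speed (gamma : R -> M) (t : R) : R :=
  let c := chart_at (gamma t) in
  let x := coord c \o gamma in
  Num.sqrt (inner (metric c) (x t) (derive1 x t) (derive1 x t)).

Definition curve_length (gamma : R -> M) : \bar R :=
  (\int[@lebesgue_measure R]_(t in `[0%R, 1%R]) (speed gamma t)%:E)%E.

Definition riemannian_dist (p q : M) : \bar R :=
  ereal_inf [set curve_length gamma | gamma in
    [set gamma | [/\ piecewise_smooth gamma 0 1, gamma 0 = p & gamma 1 = q]]].

Definition nonpositive_sectional_curvature : Prop :=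
  forall c : chart R m M, atlas c -> forall x, cimg c x ->
  forall u v : 'rV[R]_m, row_free (col_mx u v) ->
    sectional_curvature (metric c) x u v <= 0.

Definition cartan_hadamard : Prop :=
  nonpositive_sectional_curvature /\
  forall p q : M, exists gamma : R -> M,
    [/\ geodesic gamma, gamma 0 = p, gamma 1 = q,
        forall delta : R -> M, geodesic delta -> delta 0 = p -> delta 1 = q ->
          {in `[0, 1], delta =1 gamma}
      & curve_length gamma = riemannian_dist p q].

Definition gconvex_set (S : set M) : Prop :=
  forall x y, S x -> S y ->
  exists gamma : R -> M, [/\ geodesic gamma, gamma 0 = x, gamma 1 = y
    & forall t, t \in `[0, 1] -> S (gamma t)].

(* A function on S is represented by a function on M whose values off S are
   not used. *)
Definition gconvex_function (S : set M) (f : M -> R) : Prop :=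
  gconvex_set S /\
  forall gamma : R -> M, geodesic gamma ->
    (forall t, t \in `[0, 1] -> S (gamma t)) -> gamma 0 <> gamma 1 ->
    convex_function (`[0, 1]%classic : set (convex_lmodType R^o)) (f \o gamma).

End Riemannian.

(* Main.v *)
Require Import Defs.
From HB Require Import structures.
From mathcomp Require Import all_boot all_order all_algebra.
From mathcomp Require Import all_classical all_reals all_analysis.

Set Implicit Arguments.
Unset Strict Implicit.
Unset Printing Implicit Defensive.

Import Order.TTheory GRing.Theory Num.Theory.
Import numFieldNormedType.Exports.

Local Open Scope classical_set_scope.
Local Open Scope ring_scope.

(** G-convexity of a function is ordinary convexity on [[0, 1]] of its composites with geodesics
    lying in [S]. Composing with a curve commutes with pointwise maxima and linear combinations, so
    the claim reduces to the real case, settled by [convex_function_bigmax] and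
    [convex_function_sum]. Continuity is checked separately. *)

(** The starting value [g x] varies with [x] because the maximum in the theorem starts from one of
    the functions themselves. *)
Lemma continuous_bigmax (R : realType) (T : topologicalType) (I : Type)
    (r : seq I) (g : T -> R) (f : I -> T -> R) :
  continuous g -> (forall i, continuous (f i)) ->
  continuous (fun x => \big[Num.max/g x]_(i <- r) f i x).
Proof.
move=> g_cont f_cont; elim: r => [|i r IHr].
  by under eq_fun do rewrite big_nil.
under eq_fun do rewrite big_cons.
by move=> x; apply: continuous_max; [exact: f_cont | exact: IHr].
Qed.

(** Each [f i] at the combined point is bounded by the combination of its end values, hence by that
    of the two maxima, a bound independent of [i]. *)
Lemma convex_function_bigmax (R : realType) (E : lmodType R)
    (D : set (convex_lmodType E)) (I : finType) (i0 : I)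
    (f : I -> convex_lmodType E -> R) :
  (forall i, convex_function D (f i)) ->
  convex_function D (fun x => \big[Num.max/f i0 x]_i f i x).
Proof.
move=> f_conv t x y xD yD.
suff f_le i : f i (conv t x y) <=
    conv t ((\big[Num.max/f i0 x]_j f j x)%R : R^o)
           ((\big[Num.max/f i0 y]_j f j y)%R : R^o).
  (* The starting value is [f i0], so [f_le] bounds it too. *)
  by apply: bigmax_le.
apply: le_trans (f_conv i t x y xD yD) _; rewrite !convRE.
apply: lerD; apply: ler_wpM2l => //.
- exact: (le_bigmax _ (f ^~ x)).
- by rewrite subr_ge0.
- exact: (le_bigmax _ (f ^~ y)).
Qed.

Lemma convex_function_sum (R : realType) (E : lmodType R)
    (D : set (convex_lmodType E)) (I : finType) (alpha : I -> R)
    (f : I -> convex_lmodType E -> R) :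
  (forall i, 0 <= alpha i) -> (forall i, convex_function D (f i)) ->
  convex_function D (fun x => \sum_i alpha i * f i x).
Proof.
move=> alpha_ge0 f_conv t x y xD yD.
rewrite convRE !mulr_sumr -big_split; apply: ler_sum => i _ /=.
(* Factoring out [alpha i] leaves its convexity inequality scaled by a nonnegative number. *)
rewrite !(mulrCA _ (alpha i)) -mulrDr -convRE.
exact: ler_wpM2l (f_conv i t x y xD yD).
Qed.

Theorem proposition3 (R : realType) (m : nat) (M : riemannian_manifold R m)
  (hM : cartan_hadamard M) (S : set M) (hS : gconvex_set S)
  (n : nat) (hn : (0 < n)%N) (f : 'I_n -> M -> R)
  (f_cont : forall i, {within S, continuous (f i)})
  (f_conv : forall i, gconvex_function S (f i)) :
  (let fmax := fun X : M =>
     \big[Num.max/f (Ordinal hn) X]_(i < n) f i X in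
   {within S, continuous fmax} /\ gconvex_function S fmax) /\
  (forall alpha : 'I_n -> R, (forall i, 0 <= alpha i) ->
   let fsum := fun X : M => \sum_(i < n) alpha i * f i X in
   {within S, continuous fsum} /\ gconvex_function S fsum).
Proof.
split=> [fmax|alpha alpha_ge0 fsum]; split.
(* Continuity within [S] is continuity for the subspace topology, so the general lemma applies. *)
- by apply: continuous_bigmax; [exact: f_cont | exact: f_cont].
- split=> // gamma geo_gamma gammaS gamma_neq.
  apply: (@convex_function_bigmax _ R^o _ _ (Ordinal hn) (fun i => f i \o gamma)) => i.
  by apply: (f_conv i).2.
- apply: continuous_big => [|i _ x]; first exact: add_continuous.
  by apply: continuousM; [exact: cst_continuous | exact: f_cont].
- split=> // gamma geo_gamma gammaS gamma_neq.
  apply: (@convex_function_sum _ R^o _ _ alpha (fun i => f i \o gamma)) => // i.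
  by apply: (f_conv i).2.
Qed.
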